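(* Let $G$ be a group and let $A$ be a finite set with $|A|\ge 2$. Then: 1. $\mathrm{GCA}(G;A) = \mathrm{End}(G)^{\mathrm{op}}\circ\mathrm{CA}(G;A)$. 2. $\mathrm{IGCA}(G;A) = \mathrm{Aut}(G)^{\mathrm{op}}\circ\mathrm{ICA}(G;A)$.
   Context: $A^G$ is the set of all functions $x : G \to A$, with the shift action $(g\cdot x)(h) := x(g^{-1}h)$ for $x \in A^G$, $g,h\in G$. For $\phi\in\mathrm{End}(G)$, a function $\tau : A^G \to A^G$ is a $\phi$-cellular automaton if there are a finite subset $S \subseteq G$ and a function $\mu : A^S \to A$ such that $\tau(x)(g) = \mu((\phi(g^{-1})\cdot x)|_S)$ for all $x \in A^G$, $g \in G$. $\mathrm{GCA}(G;A)$ is the monoid, under composition, of all functions $A^G\to A^G$ that are $\phi$-cellular automata for some $\phi\in\mathrm{End}(G)$. $\mathrm{IGCA}(G;A)$ is the group of all bijective functions $A^G\to A^G$ that are $\phi$-cellular automata for some $\phi\in\mathrm{Aut}(G)$. $\mathrm{CA}(G;A)$ is the monoid of all $\mathrm{id}_G$-cellular automata $A^G\to A^G$, and $\mathrm{ICA}(G;A)$ is its group of units, consisting of all invertible (equivalently, bijective) $\mathrm{id}_G$-cellular automata. For $\phi\in\mathrm{End}(G)$, $\phi^\star : A^G\to A^G$ is $\phi^\star(x) := x\circ\phi$. By abuse of notation, inside $\mathrm{GCA}(G;A)$ we write $\mathrm{End}(G)^{\mathrm{op}}$ for $\{\phi^\star : \phi\in\mathrm{End}(G)\}$ and $\mathrm{Aut}(G)^{\mathrm{op}}$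 for $\{\phi^\star : \phi\in\mathrm{Aut}(G)\}$. For subsets $X,Y\subseteq\mathrm{GCA}(G;A)$, $X\circ Y := \{\tau\circ\sigma : \tau\in X, \sigma\in Y\}$. *)

(* Defs.v *)
From mathcomp Require Import all_boot.
From mathcomp Require Import finmap.
From mathcomp Require Import boolp classical_sets.

Set Implicit Arguments.
Unset Strict Implicit.
Unset Printing Implicit Defensive.

Local Open Scope classical_set_scope.

Definition shift (G : groupType) (A : Type) (g : G) (x : G -> A) : G -> A :=
  fun h => x (g^-1 * h)%g.

(* The group G may be infinite: [groupType] is the non-finite group structure.
   [S : {fset G}] coerces to the type of its elements, so [S -> A] is A^S and
   precomposing with [val] is restriction to S. *)
Definition is_gca (G : groupType) (A : Type) (phi : {multiplicative G -> G})
    (tau : (G -> A) -> (G -> A)) : Prop :=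
  exists (S : {fset G}) (mu : (S -> A) -> A),
    forall (x : G -> A) (g : G),
      tau x g = mu (fun s : S => shift (phi (g^-1)%g) x (val s)).

Definition GCA (G : groupType) (A : Type) : set ((G -> A) -> (G -> A)) :=
  [set tau | exists phi : {multiplicative G -> G}, is_gca phi tau].
Arguments GCA G A : clear implicits.

(* The automorphisms of G are its bijective endomorphisms. *)
Definition IGCA (G : groupType) (A : Type) : set ((G -> A) -> (G -> A)) :=
  [set tau | bijective tau /\
     exists2 phi : {multiplicative G -> G}, bijective phi & is_gca phi tau].
Arguments IGCA G A : clear implicits.

Definition CA (G : groupType) (A : Type) : set ((G -> A) -> (G -> A)) :=
  [set tau | is_gca (idfun : {multiplicative G -> G}) tau].
Arguments CA G A : clear implicits.

(* The inverse is itself required to be a cellular automaton. *)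
Definition ICA (G : groupType) (A : Type) : set ((G -> A) -> (G -> A)) :=
  [set tau | CA G A tau /\
     exists sigma, [/\ CA G A sigma, tau \o sigma = id & sigma \o tau = id]].
Arguments ICA G A : clear implicits.

Definition pullback (G : groupType) (A : Type) (phi : G -> G) (x : G -> A) :
    G -> A :=
  x \o phi.

Definition EndOp (G : groupType) (A : Type) : set ((G -> A) -> (G -> A)) :=
  [set pullback phi | phi in [set: {multiplicative G -> G}]].
Arguments EndOp G A : clear implicits.

Definition AutOp (G : groupType) (A : Type) : set ((G -> A) -> (G -> A)) :=
  [set pullback phi | phi in [set phi : {multiplicative G -> G} | bijective phi]].
Arguments AutOp G A : clear implicits.

Definition comp_set (T : Type) (X Y : set (T -> T)) : set (T -> T) :=
  [set tau \o sigma | tau in X & sigma in Y].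

(* Main.v *)
Require Import Defs.
From mathcomp Require Import all_boot.
From mathcomp Require Import finmap.
From mathcomp Require Import boolp classical_sets filter.

(** Unfolding the two definitions, a [phi]-cellular automaton with local rule
    [mu] sends [x] to [g |-> mu (s |-> x (phi g * s))].  This is the value at
    [phi g] of the ordinary cellular automaton with the same rule [mu], so the
    [phi]-cellular automata are exactly the maps [phi^* \o sigma] with [sigma]
    an ordinary cellular automaton ([is_gcaP]).  The first equality is a
    restatement of this.

    For the second one, [phi^*] is bijective when [phi] is, so
    [phi^* \o sigma] and [sigma] are bijective together.  It remains to see that
    the inverse of a bijective cellular automaton is again a cellular automaton
    ([bij_CA_ICA]), and this is where the finiteness of [A] enters, through the
    compactness of [A^G].  By compactness, an injective automaton [tau] is
    injective uniformly: the restriction of [tau x] to some finite [T]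
    determines [x 1] ([inj_automaton_fset]).  By equivariance it then
    determines [x g] from the restriction of [tau x] to [g T], which is to say
    that the inverse has a local rule with memory set [T].

    Compactness is used in the form of limits along an ultrafilter on the finite
    subsets of [G]: a family of configurations indexed by these subsets has a
    pointwise limit because [A] is finite, and a cellular automaton commutes
    with such limits because each value of its output depends on finitely many
    values of its input. *)

Set Implicit Arguments.
Unset Strict Implicit.
Unset Printing Implicit Defensive.

Local Open Scope classical_set_scope.

(** * Cellular automata in coordinates *)

Definition automaton (G : groupType) (A : Type) (S : {fset G})
    (mu : (S -> A) -> A) (x : G -> A) : G -> A :=
  fun g => mu (fun s => x (g * val s)%g).

(** Between groups, multiplicativity alone already forces [phi 1 = 1]. *)
Lemma multiplicativeV (G H : groupType) (phi : {multiplicative G -> H}) (g : G) :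
  phi g^-1%g = (phi g)^-1%g.
Proof.
have phi1 : phi 1%g = 1%g.
  by apply: (@mulgI _ (phi 1%g)); rewrite -gmulfM !mulg1.
by apply: (@mulgI _ (phi g)); rewrite -gmulfM !mulgV phi1.
Qed.

Lemma is_gcaP (G : groupType) (A : Type) (phi : {multiplicative G -> G})
    (tau : (G -> A) -> (G -> A)) :
  is_gca phi tau <->
  exists (S : {fset G}) (mu : (S -> A) -> A),
    tau = pullback phi \o automaton mu.
Proof.
have shiftE (S : {fset G}) (mu : (S -> A) -> A) x g :
    mu (fun s : S => shift (phi (g^-1)%g) x (val s)) =
    (pullback phi \o automaton mu) x g.
  rewrite /pullback /automaton /=; congr mu; apply/funext => s.
  by rewrite /shift multiplicativeV invgK.
split=> -[S [mu tauE]]; exists S, mu.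
- by apply/funext => x; apply/funext => g; rewrite tauE shiftE.
- by move=> x g; rewrite tauE shiftE.
Qed.

Lemma CAP (G : groupType) (A : Type) (tau : (G -> A) -> (G -> A)) :
  CA G A tau <-> exists (S : {fset G}) (mu : (S -> A) -> A), tau = automaton mu.
Proof. exact: is_gcaP. Qed.

Lemma automaton_shift (G : groupType) (A : Type) (S : {fset G})
    (mu : (S -> A) -> A) (g : G) (x : G -> A) :
  automaton mu (shift g x) = shift g (automaton mu x).
Proof.
apply/funext => h; rewrite /automaton /shift; congr mu.
by apply/funext => s; rewrite mulgA.
Qed.

Lemma pullback_bij (G : groupType) (A : Type) (phi : G -> G) :
  bijective phi -> bijective (pullback phi : (G -> A) -> (G -> A)).
Proof.
by case=> psi phiK psiK; exists (pullback psi) => x; apply/funext => g;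
  rewrite /pullback /= ?phiK ?psiK.
Qed.

(** * Compactness along an ultrafilter *)

(** Any finitely many points lie in a common finite set, so the sets
    [[set T | i \in T]] have the finite intersection property. *)
Lemma fset_ultrafilter (I : choiceType) :
  exists U : set_system {fset I},
    UltraFilter U /\ forall i, U [set T : {fset I} | i \in T].
Proof.
pose above (i : I) := [set T : {fset I} | i \in T].
have above_finI : finI setT above by move=> T _; exists T => i.
have [U [UU leU]] := ultraFilterLemma (finI_filter above_finI).
exists U; split=> // i; apply: leU.
by exists (above i) => //; exact: finI_from1.
Qed.

Lemma ultra_finite_cst (T : Type) (U : set_system T) (A : finType) (f : T -> A) :
  UltraFilter U -> exists a, U [set t | f t = a].
Proof.
move=> UU; apply: contrapT => /forallNP noU.
have : U [set t | forall a, f t <> a].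
  apply: filter_forall => a.
  by have [/noU|] := in_ultra_setVsetC [set t | f t = a] UU.
by move=> /filter_ex[t /(_ (f t))].
Qed.

Lemma ultra_pointwise_limit (T I : Type) (U : set_system T) (A : finType)
    (f : T -> I -> A) :
  UltraFilter U -> exists x : I -> A, forall i, U [set t | f t i = x i].
Proof.
move=> UU.
have /choice[x xP] := fun i => ultra_finite_cst (f^~ i) UU.
by exists x.
Qed.

(** Cellular automata are continuous for pointwise convergence: [automaton mu x]
    at [g] reads only the finitely many values of [x] on [g * S]. *)
Lemma automaton_limit (T : Type) (U : set_system T) (G : groupType) (A : Type)
    (S : {fset G}) (mu : (S -> A) -> A) (f : T -> G -> A) (x : G -> A) :
  Filter U -> (forall g, U [set t | f t g = x g]) ->
  forall g, U [set t | automaton mu (f t) g = automaton mu x g].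
Proof.
move=> FU fx g.
have : U [set t | forall s : S, f t (g * val s)%g = x (g * val s)%g].
  by apply: filter_forall => s; exact: fx.
by apply: filterS => t fxS; rewrite /automaton /=; congr mu; exact/funext.
Qed.

(** * Inverting a cellular automaton *)

(** Otherwise every finite [T] has a pair of configurations that differ at [1]
    and have images agreeing on [T].  The limits of these pairs along an
    ultrafilter still differ at [1], while their images agree everywhere. *)
Lemma inj_automaton_fset (G : groupType) (A : finType) (S : {fset G})
    (mu : (S -> A) -> A) :
  injective (automaton mu) ->
  exists T : {fset G}, forall x y : G -> A,
    {in T, automaton mu x =1 automaton mu y} -> x 1%g = y 1%g.
Proof.
move=> mu_inj; apply: contrapT => /forallNP noT.
have /choice[p pP] : forall T : {fset G}, exists p : (G -> A) * (G -> A),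
    {in T, automaton mu p.1 =1 automaton mu p.2} /\ p.1 1%g <> p.2 1%g.
  move=> T; apply: contrapT => /forallNP nop; apply: (noT T) => x y eqT.
  by apply: contrapT => neq; apply: (nop (x, y)).
have [U [UU U_mem]] := fset_ultrafilter G.
have FU : Filter U by exact: _.
have [x px] := ultra_pointwise_limit (fun T => (p T).1) UU.
have [y py] := ultra_pointwise_limit (fun T => (p T).2) UU.
have eq_xy : x = y.
  apply: mu_inj; apply/funext => g.
  have mux := automaton_limit mu FU px g.
  have muy := automaton_limit mu FU py g.
  have [T [[xT yT] gT]] := filter_ex (filterI (filterI mux muy) (U_mem g)).
  by rewrite -xT -yT; apply: (pP T).1.
have [T [xT yT]] := filter_ex (filterI (px 1%g) (py 1%g)).
by apply: (pP T).2; rewrite xT yT eq_xy.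
Qed.

(** The rule of the left inverse reads off [x 1] from the values of
    [automaton mu x] on the set given by [inj_automaton_fset]; translating by
    [g^-1] turns [x g] into a value at [1]. *)
Lemma inj_automaton_cancel (G : groupType) (A : finType) (a0 : A) (S : {fset G})
    (mu : (S -> A) -> A) :
  injective (automaton mu) ->
  exists (T : {fset G}) (nu : (T -> A) -> A),
    cancel (automaton mu) (automaton nu).
Proof.
move=> /inj_automaton_fset[T T1]; exists T.
have /choice[nu nuP] : forall p : T -> A, exists a,
    forall x, (forall t : T, automaton mu x (val t) = p t) -> x 1%g = a.
  move=> p.
  have [[x xp]|nox] :=
    pselect (exists x, forall t : T, automaton mu x (val t) = p t).
    exists (x 1%g) => y yp; apply: T1 => t tT.
    by rewrite (yp [` tT]%fset) (xp [` tT]%fset).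
  (* A pattern with no preimage may be given any value. *)
  by exists a0 => x xp; case: nox; exists x.
exists nu => x; apply/funext => g.
have -> : x g = shift g^-1%g x 1%g by rewrite /shift invgK mulg1.
by apply/esym/nuP => t; rewrite automaton_shift /shift invgK.
Qed.

Lemma bij_CA_ICA (G : groupType) (A : finType) (a0 : A)
    (tau : (G -> A) -> (G -> A)) :
  CA G A tau -> bijective tau -> ICA G A tau.
Proof.
move=> tauCA tau_bij; split=> //.
have /CAP[S [mu tauE]] := tauCA; rewrite {tau}tauE in tauCA tau_bij *.
have [T [nu muK]] := inj_automaton_cancel a0 (bij_inj tau_bij).
exists (automaton nu); split; first by apply/CAP; exists T, nu.
- by apply/funext => x; exact: (bij_can_sym tau_bij _).2 muK x.
- by apply/funext => x; exact: muK.
Qed.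

Lemma ICA_bij (G : groupType) (A : Type) (tau : (G -> A) -> (G -> A)) :
  ICA G A tau -> bijective tau.
Proof.
by case=> _ [sigma [_ tauK sigmaK]]; exists sigma => x;
  [exact: (congr1 (@^~ x) sigmaK) | exact: (congr1 (@^~ x) tauK)].
Qed.

Theorem lemma8 (G : groupType) (A : finType) (hA : 1 < #|A|) :
  GCA G A = comp_set (EndOp G A) (CA G A) /\
  IGCA G A = comp_set (AutOp G A) (ICA G A).
Proof.
have [a0 _] : exists a0 : A, a0 \in A by apply/card_gt0P; exact: ltnW hA.
split; apply/seteqP; split=> tau.
- case=> phi /is_gcaP[S [mu ->]].
  exists (pullback phi); first by exists phi.
  by exists (automaton mu) => //; apply/CAP; exists S, mu.
- case=> _ [phi _ <-] [sigma /CAP[S [mu ->]] <-].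
  by exists phi; apply/is_gcaP; exists S, mu.
- case=> tau_bij [phi phi_bij /is_gcaP[S [mu tauE]]].
  exists (pullback phi); first by exists phi.
  exists (automaton mu) => //.
  apply: (bij_CA_ICA a0); first by apply/CAP; exists S, mu.
  (* [automaton mu] is [tau] followed by the inverse of [pullback phi]. *)
  have [q phiK qK] := pullback_bij A phi_bij.
  have q_bij : bijective q by exists (pullback phi).
  apply: (eq_bij (bij_comp q_bij tau_bij)) => x.
  by rewrite tauE /=; exact: phiK.
- case=> _ [phi phi_bij <-] [sigma sigmaICA <-]; split.
    exact: bij_comp (pullback_bij A phi_bij) (ICA_bij sigmaICA).
  exists phi => //; apply/is_gcaP.
  by have [/CAP[S [mu ->]] _] := sigmaICA; exists S, mu.
Qed.
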